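(* Let $(\mathbf{X},\mathbf{Y})=\{(X^n,Y^n)\}_{n=1}^{\infty}$ be a pair of general sources with finite alphabets $\mathcal{X},\mathcal{Y}$, let $\hat{\mathcal{X}}$ be a finite output alphabet, and let $\{c_n\}_{n=1}^\infty$, $c_n:\mathcal{X}^n\times\hat{\mathcal{X}}^n\to[0,\infty)$, be uniformly bounded cost functions. For any real numbers $\epsilon,R\ge 0$, the minimum worst-case cost $C_{\rm w}(\epsilon,R)$ under the weak independence criterion satisfies $$C_{\rm w}(\epsilon,R)=\inf_{\substack{\hat{\mathbf{X}}:\ \mathbf{Y}-\mathbf{X}-\hat{\mathbf{X}},\\ I(\mathbf{Y};\hat{\mathbf{X}})\le\epsilon,\ \overline{H}(\hat{\mathbf{X}}|\mathbf{X})\le R}} \overline{c}(\mathbf{X},\hat{\mathbf{X}}),$$ where the infimum is over all sequences $\hat{\mathbf{X}}=\{\hat X^n\}_{n=1}^\infty$ of random variables, $\hat X^n$ taking values in $\hat{\mathcal{X}}^n$ and jointly distributed with $(X^n,Y^n)$, that satisfy the indicated constraints.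
   Context: $\mathcal{X},\mathcal{Y},\hat{\mathcal{X}}$ are finite nonempty sets; $\log$ is the natural logarithm; $I(\cdot;\cdot)$ is mutual information. A pair of general sources $(\mathbf{X},\mathbf{Y})=\{(X^n,Y^n)\}_{n=1}^\infty$ is an arbitrary sequence of pairs of random variables, $(X^n,Y^n)$ taking values in $\mathcal{X}^n\times\mathcal{Y}^n$ (no consistency between different $n$ is required). The cost functions $c_n:\mathcal{X}^n\times\hat{\mathcal{X}}^n\to[0,\infty)$ satisfy $\sup_{n\ge1}\sup_{(x^n,\hat x^n)}c_n(x^n,\hat x^n)<\infty$. For a positive integer $M_n$, $U_{M_n}$ is uniformly distributed on $\mathcal{U}_{M_n}=\{1,\dots,M_n\}$ and independent of $(X^n,Y^n)$. An encoder is a (deterministic) map $f_n:\mathcal{X}^n\times\mathcal{U}_{M_n}\to\hat{\mathcal{X}}^n$. For a sequence of real-valued random variables $Z_n$: $\mathrm{p}\text{-}\limsup_{n\to\infty}Z_n=\inf\{\alpha:\lim_{n\to\infty}\Pr\{Z_n>\alpha\}=0\}$. For $R,\Gamma,\epsilon\ge0$, $(R,\Gamma)$ is $\epsilon$-weakly achievable in the sense of the worst-case cost if there exist a sequence of positive integers $\{M_n\}$ and encoders $\{f_n\}$ such that $\limsup_{n\to\infty}\frac1n\log M_n\le R$, $\limsup_{n\to\infty}\frac1n I(Y^n;f_n(X^n,U_{M_n}))\le\epsilon$, and $\mathrm{p}\text{-}\limsup_{n\to\infty}c_n(X^n,f_n(X^n,U_{M_n}))\le\Gamma$. Define $C_{\rm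 w}(\epsilon,R)=\inf\{\Gamma\ge 0:(R,\Gamma)\text{ is }\epsilon\text{-weakly achievable in the sense of the worst-case cost}\}$. Define $I(\mathbf{Y};\hat{\mathbf{X}})=\limsup_{n\to\infty}\frac1nI(Y^n;\hat X^n)$, $\overline{H}(\hat{\mathbf{X}}|\mathbf{X})=\mathrm{p}\text{-}\limsup_{n\to\infty}\frac1n\log\frac{1}{P_{\hat X^n|X^n}(\hat X^n|X^n)}$, $\overline{c}(\mathbf{X},\hat{\mathbf{X}})=\mathrm{p}\text{-}\limsup_{n\to\infty}c_n(X^n,\hat X^n)$. The notation $\mathbf{Y}-\mathbf{X}-\hat{\mathbf{X}}$ means that $Y^n-X^n-\hat X^n$ is a Markov chain for every $n\ge1$. *)

(* Defs.v *)
From HB Require Import structures.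
From mathcomp Require Import all_boot all_order all_algebra.
From mathcomp Require Import all_classical all_reals all_analysis.
Set Implicit Arguments.
Unset Strict Implicit.
Unset Printing Implicit Defensive.
Import Order.TTheory GRing.Theory Num.Theory.
Import numFieldNormedType.Exports.
Local Open Scope classical_set_scope.
Local Open Scope ring_scope.

(* A probability mass function on a finite sample space [W] makes every
   function [W -> A] a random variable. *)
Section FiniteProbability.
Variables (R : realType) (W : finType).
Implicit Types (P : W -> R) (E F : pred W).

Definition is_pmf P : Prop := (forall w, 0 <= P w) /\ \sum_w P w = 1.

Definition prob P E : R := \sum_(w | E w) P w.

Definition cond_prob P E F : R := prob P [pred w | E w && F w] / prob P F.

(* Natural logarithm. A pair (a, b) of probability 0 contributes 0, because of
   the leading factor. *)
Definition mutual_info P (A B : finType) (V : W -> A) (Z : W -> B) : R :=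
  \sum_(a : A) \sum_(b : B)
    prob P [pred w | (V w == a) && (Z w == b)] *
    ln (prob P [pred w | (V w == a) && (Z w == b)] /
        (prob P [pred w | V w == a] * prob P [pred w | Z w == b])).

Definition markov_chain P (A B C : finType)
    (V : W -> A) (S : W -> B) (Z : W -> C) : Prop :=
  forall a b c, 0 < prob P [pred w | S w == b] ->
    cond_prob P [pred w | (V w == a) && (Z w == c)] [pred w | S w == b] =
    cond_prob P [pred w | V w == a] [pred w | S w == b] *
    cond_prob P [pred w | Z w == c] [pred w | S w == b].

End FiniteProbability.

(* The n-th random variables of a sequence live on their own sample space [W n];
   nothing relates the spaces for different n. The values at n = 0 are
   irrelevant to all the limits below. *)
Section Spectral.
Variables (R : realType) (W : nat -> finType).
Local Open Scope ereal_scope.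

Definition p_limsup (P : forall n, W n -> R)
    (Z : forall n, W n -> R) : \bar R :=
  ereal_inf [set a%:E | a in
    [set a : R | prob (P n) [pred w | (a < Z n w)%R] @[n --> \oo] --> (0 : R)%R]].

Definition mutual_info_rate (P : forall n, W n -> R)
    (A B : nat -> finType)
    (V : forall n, W n -> A n) (Z : forall n, W n -> B n) : \bar R :=
  limn_esup (fun n => (n%:R^-1 * mutual_info (P n) (V n) (Z n))%R%:E).

(* Conditional sup-entropy rate of [Z] given [S]. *)
Definition cond_sup_entropy (P : forall n, W n -> R)
    (A B : nat -> finType)
    (Z : forall n, W n -> A n) (S : forall n, W n -> B n) : \bar R :=
  p_limsup P (fun n w => n%:R^-1 *
    ln (1 / cond_prob (P n) [pred v | Z n v == Z n w]
                            [pred v | S n v == S n w]))%R.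

End Spectral.

Section Sources.
Variables (R : realType) (X Y Xh : finType).

Definition is_source (P : forall n, n.-tuple X * n.-tuple Y -> R) : Prop :=
  forall n, (0 < n)%N -> is_pmf (P n).

Definition is_cost (c : forall n, n.-tuple X -> n.-tuple Xh -> R) : Prop :=
  forall n, (0 < n)%N -> forall x xh, 0 <= c n x xh.

Definition uniformly_bounded
    (c : forall n, n.-tuple X -> n.-tuple Xh -> R) : Prop :=
  exists B : R, forall n, (0 < n)%N -> forall x xh, c n x xh <= B.

(* Joint law of (X^n, Y^n, U) with U uniform on ['I_M] and independent of
   (X^n, Y^n). *)
Definition with_uniform n (p : n.-tuple X * n.-tuple Y -> R) (M : nat)
    (w : n.-tuple X * n.-tuple Y * 'I_M) : R := p w.1 * M%:R^-1.

Definition weakly_achievable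
    (P : forall n, n.-tuple X * n.-tuple Y -> R)
    (c : forall n, n.-tuple X -> n.-tuple Xh -> R)
    (eps r Gamma : R) : Prop :=
  exists (M : nat -> nat) (f : forall n, n.-tuple X * 'I_(M n) -> n.-tuple Xh),
    [/\ forall n, (0 < n)%N -> (0 < M n)%N,
        (limn_esup (fun n => (n%:R^-1 * ln (M n)%:R)%:E) <= r%:E)%E,
        (mutual_info_rate (fun n => with_uniform (P n) (M := M n))
           (fun n w => w.1.2) (fun n w => f n (w.1.1, w.2)) <= eps%:E)%E &
        (p_limsup (fun n => with_uniform (P n) (M := M n))
           (fun n w => c n w.1.1 (f n (w.1.1, w.2))) <= Gamma%:E)%E].

Definition min_worst_cost
    (P : forall n, n.-tuple X * n.-tuple Y -> R)
    (c : forall n, n.-tuple X -> n.-tuple Xh -> R) (eps r : R) : \bar R :=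
  ereal_inf [set G%:E | G in
    [set G : R | 0 <= G /\ weakly_achievable P c eps r G]].

(* [Q n] is the joint law of (X^n, Y^n, Xh^n), and [P n] that of (X^n, Y^n). *)
Definition is_joint_extension
    (P : forall n, n.-tuple X * n.-tuple Y -> R)
    (Q : forall n, n.-tuple X * n.-tuple Y * n.-tuple Xh -> R) : Prop :=
  forall n, (0 < n)%N ->
    is_pmf (Q n) /\ forall xy, prob (Q n) [pred w | w.1 == xy] = P n xy.

Definition markov_source
    (Q : forall n, n.-tuple X * n.-tuple Y * n.-tuple Xh -> R) : Prop :=
  forall n, (0 < n)%N ->
    markov_chain (Q n) (fun w => w.1.2) (fun w => w.1.1) (fun w => w.2).

Definition sup_cost
    (c : forall n, n.-tuple X -> n.-tuple Xh -> R)
    (Q : forall n, n.-tuple X * n.-tuple Y * n.-tuple Xh -> R) : \bar R :=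
  p_limsup Q (fun n w => c n w.1.1 w.2).

End Sources.

(* Main.v *)
(* Converse: the joint law of (X^n, Y^n, f_n(X^n, U)) is itself a competitor, since
   its conditional probabilities given X^n are multiples of 1/M_n, so that the
   conditional self-information is at most ln M_n.
   Direct part: given a competitor, choose g_n -> 0 with
   Pr{1/n ln 1/P(Xh^n|X^n) > r + g_n} -> 0 and M_n about exp(n(r + 2 g_n)). Rounding
   each P(.|x) to multiples of 1/M_n only loses the outcomes of probability below
   exp(-n(r + g_n)), plus exp(-n g_n), so the code simulates the joint law up to an
   l1 error tending to 0. Such an error moves the cost probabilities by o(1) and, by
   uniform continuity of entropy, the mutual information by o(n). *)
Require Import Defs.
From HB Require Import structures.
From mathcomp Require Import all_boot all_order all_algebra.
From mathcomp Require Import all_classical all_reals all_analysis.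
From mathcomp Require Import ring lra.
Set Implicit Arguments.
Unset Strict Implicit.
Unset Printing Implicit Defensive.
Import Order.TTheory GRing.Theory Num.Theory.
Import numFieldNormedType.Exports.
Local Open Scope classical_set_scope.
Local Open Scope ring_scope.

(** * Pushforwards of finite laws, l1 distance, and continuity of entropy and mutual information *)

Section FiniteLaws.
Variable R : realType.

Definition push (W A : finType) (P : W -> R) (T : W -> A) (a : A) : R :=
  prob P [pred w | T w == a].

Definition l1dist (W : finType) (P Q : W -> R) : R := \sum_w `|P w - Q w|.

Definition entropy (W : finType) (P : W -> R) : R := - \sum_w P w * ln (P w).

Lemma prob_ge0 (W : finType) (P : W -> R) E : is_pmf P -> 0 <= prob P E.
Proof. by case=> P0 _; apply: sumr_ge0. Qed.

Lemma prob_le1 (W : finType) (P : W -> R) E : is_pmf P -> prob P E <= 1.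
Proof.
case=> P0 <-; rewrite [leRHS](bigID E) /= lerDl.
exact: sumr_ge0.
Qed.

Lemma le_prob (W : finType) (P : W -> R) (E F : pred W) : is_pmf P ->
  (forall w, 0 < P w -> E w -> F w) -> prob P E <= prob P F.
Proof.
case=> P0 _ EF; rewrite /prob big_mkcond [leRHS]big_mkcond /=.
apply: ler_sum => w _; have := P0 w; rewrite le_eqVlt => /predU1P[<-|Pw].
  by do 2!case: ifP.
by case: ifPn => [/(EF _ Pw) ->//|_]; case: ifP.
Qed.

Lemma prob_gt0 (W : finType) (P : W -> R) (E : pred W) w : is_pmf P ->
  0 < P w -> E w -> 0 < prob P E.
Proof.
move=> [P0 _] Pw Ew; rewrite /prob (bigD1 w) //= ltr_pwDl //.
exact: sumr_ge0.
Qed.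

Lemma prob_eq0 (W : finType) (P : W -> R) (E : pred W) w : is_pmf P ->
  prob P E = 0 -> E w -> P w = 0.
Proof.
move=> Pp PE Ew; apply/eqP; apply: contra_eqT PE => Pw0.
by rewrite gt_eqF // (prob_gt0 Pp _ Ew) // lt0r Pw0 Pp.1.
Qed.

Lemma prob_push (W A : finType) (P : W -> R) (T : W -> A) (E : pred A) :
  prob (push P T) E = prob P [pred w | E (T w)].
Proof.
rewrite /push /prob (partition_big T E) //=.
apply: eq_bigr => a Ea; apply: eq_bigl => w /=.
by case: eqP => [->|]; rewrite ?Ea // andbF.
Qed.

Lemma push_comp (W A B : finType) (P : W -> R) (T : W -> A) (S : A -> B) :
  push (push P T) S = push P (S \o T).
Proof. by apply/funext => b; rewrite {1}/push prob_push. Qed.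

Lemma sum_push (W A : finType) (P : W -> R) (T : W -> A) (F : A -> R) :
  \sum_a push P T a * F a = \sum_w P w * F (T w).
Proof.
rewrite [RHS](partition_big T predT) //=; apply: eq_bigr => a _.
by rewrite mulr_suml; apply: eq_bigr => w /eqP ->.
Qed.

Lemma push_pmf (W A : finType) (P : W -> R) (T : W -> A) :
  is_pmf P -> is_pmf (push P T).
Proof.
move=> Pp; split=> [a|]; first exact: prob_ge0.
under eq_bigr do rewrite -[push _ _ _]mulr1.
by rewrite sum_push; under eq_bigr do rewrite mulr1; exact: Pp.2.
Qed.

Lemma pmf_le1 (W : finType) (P : W -> R) w : is_pmf P -> P w <= 1.
Proof. by move=> Pp; have := prob_le1 (pred1 w) Pp; rewrite /prob big_pred1_eq. Qed.

Lemma pmf_card_gt0 (W : finType) (P : W -> R) : is_pmf P -> (0 < #|W|)%N.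
Proof.
case=> _ P1; rewrite lt0n; apply/eqP => W0.
move: P1; rewrite big_pred0 => [/eqP|w]; first by rewrite eq_sym oner_eq0.
by have := fintype0 w W0.
Qed.

Lemma l1dist_push (W A : finType) (P Q : W -> R) (T : W -> A) :
  l1dist (push P T) (push Q T) <= l1dist P Q.
Proof.
rewrite /l1dist [leRHS](partition_big T predT) //=; apply: ler_sum => a _.
by rewrite /push /prob -sumrB ler_norm_sum.
Qed.

Lemma prob_le_l1dist (W : finType) (P Q : W -> R) E :
  prob Q E <= prob P E + l1dist P Q.
Proof.
rewrite -lerBlDl /prob -sumrB /l1dist [leRHS](bigID E) /=.
rewrite ler_wpDr ?sumr_ge0 //; apply: ler_sum => w _.
by rewrite distrC ler_norm.
Qed.

Lemma mutual_info_push (W A B C : finType) (P : W -> R) (T : W -> C)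
    (V : C -> A) (Z : C -> B) :
  mutual_info (push P T) V Z = mutual_info P (V \o T) (Z \o T).
Proof.
rewrite /mutual_info; apply: eq_bigr => a _; apply: eq_bigr => b _.
by rewrite !prob_push.
Qed.

(** After transport to the joint law [J] of the pair, the identity holds term by term: a pair of
    mass 0 contributes 0 to both sides, and a pair of positive mass has positive marginals, so the
    logarithm of the quotient splits. *)
Lemma mutual_info_entropy (W A B : finType) (P : W -> R)
    (V : W -> A) (Z : W -> B) : is_pmf P ->
  mutual_info P V Z =
  entropy (push P V) + entropy (push P Z) - entropy (push P (fun w => (V w, Z w))).
Proof.
move=> Pp; pose J := push P (fun w => (V w, Z w)).
have JV : push P V = push J fst by rewrite push_comp.
have JZ : push P Z = push J snd by rewrite push_comp.
have Jp : is_pmf J by exact: push_pmf.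
rewrite /entropy -/J JV JZ !(sum_push J) opprK -opprD -big_split /= addrC -sumrB.
rewrite /mutual_info pair_bigA /=. apply: eq_bigr => -[a b] _ /=.
rewrite -mulrDr -mulrBr -[prob P _]/(J (a, b)).
rewrite -[prob P [pred w | V w == a]]/(push P V a).
rewrite -[prob P [pred w | Z w == b]]/(push P Z b) JV JZ.
have := Jp.1 (a, b); rewrite le_eqVlt => /predU1P[<-|J0]; first by rewrite !mul0r.
have V0 : 0 < push J fst a by apply: (prob_gt0 Jp J0) => /=.
have Z0 : 0 < push J snd b by apply: (prob_gt0 Jp J0) => /=.
by rewrite ln_div ?posrE ?mulr_gt0 // lnM.
Qed.

(* For [a <= b] and [h t := - t ln t], monotonicity of [ln] gives
   [h b - h a <= h (b - a)] and [ln u <= u - 1] gives [h a - h b <= b - a]. *)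
Lemma xlnx_dist (a b N : R) : 0 <= a <= 1 -> 0 <= b <= 1 -> 0 < N ->
  `|a * ln a - b * ln b| <= `|a - b| * ln N + N^-1.
Proof.
move=> a01 b01 N0; wlog ab : a b a01 b01 / a <= b.
  move=> H; have [/H|/ltW/H] := leP a b; first exact.
  by rewrite distrC [`|b - a|]distrC; exact.
have := ab; rewrite le_eqVlt => /predU1P[->|ltab].
  by rewrite !subrr !normr0 mul0r add0r invr_ge0 ltW.
have [/andP[a0 a1] /andP[b0 b1]] := (a01, b01).
rewrite [`|a - b|]distrC (gtr0_norm (x := b - a)) ?subr_gt0 //.
set d := b - a; have d0 : 0 < d by rewrite subr_gt0.
have d1 : d <= 1 by rewrite /d; lra.
have bgt0 : 0 < b by apply: le_lt_trans ltab.
have lnb : ln b <= 0 by apply: ln_le0.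
have lnd : ln d <= 0 by apply: ln_le0.
(* This is [ln u <= u - 1] at [u = 1 / (d * N)], multiplied by [d]. *)
have key : - (d * ln d) <= d * ln N + N^-1 - d.
  have dN : 0 < (d * N)^-1 by rewrite invr_gt0 mulr_gt0.
  have := @le_ln1Dx R ((d * N)^-1 - 1).
  rewrite ltrBrDl subrr => /(_ dN); rewrite addrC subrK.
  rewrite lnV ?posrE ?mulr_gt0 // lnM // => /(ler_wpM2l (ltW d0)).
  rewrite mulrBr mulr1 invfM mulrA mulfV ?gt_eqF // mul1r mulrN mulrDr.
  lra.
have dlnd : d * ln d <= 0 by rewrite mulr_ge0_le0 // ltW.
rewrite ler_norml; apply/andP; split; last first.
  have h1 : a * ln a <= a * ln b.
    have := a0; rewrite le_eqVlt => /predU1P[<-|a0']; first by rewrite !mul0r.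
    by rewrite ler_pM2l // ler_ln.
  have h2 : d * ln d <= d * ln b.
    by rewrite ler_pM2l // ler_ln // /d; lra.
  have : b * ln b = a * ln b + d * ln b by rewrite /d; ring.
  lra.
have h3 : a * (ln b - ln a) <= d.
  have := a0; rewrite le_eqVlt => /predU1P[<-|a0'].
    by rewrite mul0r ltW.
  have ba : 0 < b / a by rewrite divr_gt0.
  have := @le_ln1Dx R (b / a - 1).
  rewrite ltrBrDl subrr => /(_ ba); rewrite addrC subrK ln_div //.
  move=> /(ler_wpM2l a0); rewrite [a * (b / a - 1)]mulrBr mulr1 mulrCA mulfV ?gt_eqF // mulr1.
  by [].
have h4 : d * ln b <= 0 by rewrite mulr_ge0_le0 // ltW.
have : b * ln b - a * ln a = d * ln b + a * (ln b - ln a) by rewrite /d; ring.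
lra.
Qed.

(** Apply [xlnx_dist] at each point with [N = #|W|], so that the additive errors [1 / N] sum to
    1. *)
Lemma entropy_dist (W : finType) (P Q : W -> R) : is_pmf P -> is_pmf Q ->
  `|entropy P - entropy Q| <= l1dist P Q * ln #|W|%:R + 1.
Proof.
move=> Pp Qp; have W0 : 0 < #|W|%:R :> R by rewrite ltr0n; exact: pmf_card_gt0 Pp.
rewrite /entropy opprK addrC -sumrB (le_trans (ler_norm_sum _ _ _)) //.
have E1 : \sum_(w : W) #|W|%:R^-1 = 1 :> R.
  by rewrite sumr_const -[LHS]mulr_natl mulfV // gt_eqF.
rewrite -[X in _ <= _ + X]E1 mulr_suml -big_split /=; apply: ler_sum => w _.
rewrite [`|P w - Q w|]distrC; apply: xlnx_dist; rewrite ?Pp.1 ?Qp.1 ?pmf_le1 //.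
Qed.

(** The common marginal of [V] cancels its entropy. The entropies of [Z] and of the pair move by
    [entropy_dist], and the 2 collects their two additive constants. *)
Lemma mutual_info_le_l1dist (W A B : finType) (P Q : W -> R)
    (V : W -> A) (Z : W -> B) : is_pmf P -> is_pmf Q ->
  push P V = push Q V ->
  mutual_info Q V Z <= mutual_info P V Z +
    l1dist P Q * (ln #|B|%:R + ln #|{: A * B}|%:R) + 2.
Proof.
move=> Pp Qp PQV; rewrite !mutual_info_entropy // PQV.
set VZ := (fun w => (V w, Z w)).
have B0 := pmf_card_gt0 (push_pmf Z Pp).
have AB0 := pmf_card_gt0 (push_pmf VZ Pp).
have ln0 n : (0 < n)%N -> 0 <= ln n%:R :> R.
  by move=> n0; rewrite ln_ge0 // ler1n.
have := entropy_dist (push_pmf Z Pp) (push_pmf Z Qp).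
have := entropy_dist (push_pmf VZ Pp) (push_pmf VZ Qp).
have := ler_wpM2r (ln0 _ B0) (l1dist_push P Q Z).
have := ler_wpM2r (ln0 _ AB0) (l1dist_push P Q VZ).
rewrite !ler_norml mulrDr => *; lra.
Qed.

End FiniteLaws.

(** * Simulating a channel by a deterministic map fed with a uniform seed *)

Section Simulation.
Variable R : realType.

(** Write each [z] down [k z] times in one sequence and let [g u] be its entry at position [u].
    Positions past the end get the default [z0], which can only enlarge a fiber. *)
Lemma exists_fibers_ge (Z : finType) (k : Z -> nat) (M : nat) (z0 : Z) :
  (\sum_z k z <= M)%N ->
  exists g : 'I_M -> Z, forall z, (k z <= #|[pred u | g u == z]|)%N.
Proof.
move=> kM; pose s := flatten [seq nseq (k z) z | z <- enum Z].
have size_s : size s = (\sum_z k z)%N.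
  rewrite /s size_flatten /shape -map_comp sumnE big_map big_enum /=.
  by apply: eq_bigr => z _; rewrite size_nseq.
exists (fun u => nth z0 s u) => z.
have -> : k z = count_mem z s.
  rewrite /s count_flatten -map_comp sumnE big_map big_enum /= (bigD1 z) //=.
  rewrite count_nseq /= eqxx mul1n big1 ?addn0 // => z' /negPf z'z.
  by rewrite count_nseq /= z'z.
rewrite -sum1_count (big_nth z0) big_mkord -sum1_card.
rewrite -(big_mkord (fun i => nth z0 s i == z) (fun=> 1%N)).
rewrite -(big_mkord (fun i => nth z0 s i == z) (fun=> 1%N)).
rewrite [leqRHS](@big_cat_nat _ _ _ (size s)) //= ?leq_addr //.
by rewrite size_s.
Qed.

(* Only the outcomes of probability at least [t] are rounded, down to multiples
   of [1 / M]; there are at most [1 / t] of them. *)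
Lemma uniform_approx (Z : finType) (p : Z -> R) (M : nat) (t : R) :
  is_pmf p -> (0 < M)%N -> 0 < t ->
  exists g : 'I_M -> Z,
    \sum_z `|p z - #|[pred u | g u == z]|%:R / M%:R| <=
    2 * (prob p [pred z | p z < t] + (t * M%:R)^-1).
Proof.
move=> pp M0 t0; have MR : 0 < M%:R :> R by rewrite ltr0n.
have [p0 p1] := pp.
have /card_gt0P[z0 _] := pmf_card_gt0 pp.
pose k z := if p z < t then 0%N else Num.trunc (p z * M%:R).
have pM z : 0 <= p z * M%:R by rewrite mulr_ge0.
have [|g kg] := @exists_fibers_ge Z k M z0.
  rewrite -(ler_nat R) natr_sum.
  have -> : M%:R = \sum_z p z * M%:R by rewrite -mulr_suml p1 mul1r.
  by apply: ler_sum => z _; rewrite /k; case: ifP; rewrite ?truncn_le ?pM.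
exists g; pose q z := #|[pred u | g u == z]|%:R / M%:R : R.
have q1 : \sum_z q z = 1.
  rewrite /q -mulr_suml -natr_sum.
  have -> : (\sum_z #|[pred u | g u == z]|)%N = M.
    rewrite -[RHS]card_ord -sum1_card (partition_big g predT) //=.
    by apply: eq_bigr => z _; rewrite sum1_card.
  by rewrite mulfV // gt_eqF.
(* A small outcome loses at most its own mass. Any other loses at most [1 / M], which is at most
   [p z / (t * M)] because [t <= p z]; the second term therefore sums to [1 / (t * M)]. *)
have excess z : Num.max (p z - q z) 0 <=
    (if p z < t then p z else 0) + p z * (t * M%:R)^-1.
  have tM : 0 <= p z * (t * M%:R)^-1.
    by rewrite mulr_ge0 // invr_ge0 mulr_ge0 // ltW.
  have q0 : 0 <= q z by rewrite divr_ge0.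
  rewrite ge_max; apply/andP; split; last by case: ifP; rewrite ?addr_ge0.
  have := kg z; rewrite /k; case: ltP => [_ _|tp]; first by lra.
  rewrite -(ler_nat R) => kz; rewrite add0r.
  have lt_p : p z - q z <= M%:R^-1.
    rewrite -(ler_pM2r MR) mulrBl mulVf ?gt_eqF // /q divfK ?gt_eqF //.
    have /andP[_] := truncn_itv (pM z); rewrite -natr1; lra.
  apply: le_trans lt_p _; rewrite invfM mulrA ler_peMl ?invr_ge0 ?(ltW MR) //.
  by rewrite ler_pdivlMr // mul1r.
(* Both laws have mass 1, so positive and negative parts of the difference have equal sums. Lower
   bounds on the fibers thus control the whole distance. *)
have -> : \sum_z `|p z - q z| = 2 * \sum_z Num.max (p z - q z) 0.
  have pq : \sum_z (p z - q z) = 0 by rewrite sumrB p1 q1 subrr.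
  transitivity (\sum_z (2 * Num.max (p z - q z) 0 - (p z - q z))); last first.
    by rewrite sumrB -mulr_sumr pq subr0.
  apply: eq_bigr => z _.
  by case: (lerP (p z - q z) 0) => h; rewrite ?(ler0_norm h) ?(gtr0_norm h); lra.
rewrite ler_pM2l // (le_trans (ler_sum _ (fun z _ => excess z))) //.
by rewrite big_split /= -big_mkcond -mulr_suml p1 mul1r.
Qed.

(* [with_uniform] is convertible to an instance of this. *)
Definition uniform_law (A : finType) (p : A -> R) (M : nat) (w : A * 'I_M) : R :=
  p w.1 * M%:R^-1.

Lemma prob_uniform_law (A : finType) (p : A -> R) (M : nat)
    (E : pred A) (F : pred 'I_M) :
  prob (@uniform_law A p M) [pred w | E w.1 && F w.2] =
  prob p E * (#|F|%:R / M%:R).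
Proof.
rewrite /prob -(pair_big E F (fun a _ => p a * M%:R^-1)) /= mulr_suml.
apply: eq_bigr => a _; rewrite sumr_const -[LHS]mulr_natr.
by rewrite mulrAC -mulrA.
Qed.

Definition code_law (A B Z : finType) (p : A * B -> R) (M : nat)
    (f : A * 'I_M -> Z) : A * B * Z -> R :=
  push (@uniform_law _ p M) (fun w => (w.1, f (w.1.1, w.2))).

Section CodeLaw.
Variables (A B Z : finType) (p : A * B -> R) (M : nat) (f : A * 'I_M -> Z).
Hypotheses (pp : is_pmf p) (M0 : (0 < M)%N).
Local Notation N x z := #|[pred u | f (x, u) == z]|.

Let MV : M%:R / M%:R = 1 :> R.
Proof. by rewrite mulfV // pnatr_eq0 -lt0n. Qed.

Lemma uniform_law_pmf : is_pmf (@uniform_law _ p M).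
Proof.
split=> [w|]; first by rewrite mulr_ge0 ?pp.1 ?invr_ge0.
have := prob_uniform_law p (M := M) predT predT.
by rewrite card_ord MV mulr1 [RHS]pp.2.
Qed.

Lemma code_law_pmf : is_pmf (code_law p f).
Proof. exact/push_pmf/uniform_law_pmf. Qed.

Lemma prob_code_law_fst (E : pred (A * B)) :
  prob (code_law p f) [pred w | E w.1] = prob p E.
Proof.
rewrite prob_push -[RHS]mulr1 -MV -[in X in _ * (X / _)](card_ord M).
rewrite -(prob_uniform_law p E predT); apply: eq_bigl => w /=.
by rewrite andbT.
Qed.

(** Once [x] is fixed, the output is a function of the seed alone, and the seed is independent of
    the source pair. *)
Lemma prob_code_law (E : pred (A * B)) x z :
  prob (code_law p f) [pred w | [&& E w.1, w.1.1 == x & w.2 == z]] =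
  prob p [pred xy | E xy && (xy.1 == x)] * (N x z)%:R / M%:R.
Proof.
rewrite prob_push -mulrA -prob_uniform_law; apply: eq_bigl => w /=.
by rewrite -andbA; case: eqP => [->|].
Qed.

Lemma code_lawE x y z : code_law p f (x, y, z) = p (x, y) * (N x z)%:R / M%:R.
Proof.
have := prob_code_law (pred1 (x, y)) x z.
rewrite /prob (big_pred1 (x, y, z)) => [->|[[x' y'] z'] /=]; last first.
  by rewrite !xpair_eqE; case: eqP.
rewrite (big_pred1 (x, y)) // => -[x' y'] /=.
by rewrite xpair_eqE andbAC andbb.
Qed.

Lemma cond_prob_code_law x z : 0 < prob p [pred xy | xy.1 == x] ->
  cond_prob (code_law p f) [pred w | w.2 == z] [pred w | w.1.1 == x] =
  (N x z)%:R / M%:R.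
Proof.
move=> x0; rewrite /cond_prob (prob_code_law_fst [pred xy | xy.1 == x]).
have := prob_code_law predT x z; rewrite /= => E.
rewrite (_ : prob _ _ = prob p [pred xy | xy.1 == x] * (N x z)%:R / M%:R).
  by rewrite -[X in X / _ = _]mulrA mulrC mulKf ?gt_eqF.
by rewrite -E; apply: eq_bigl => w /=; rewrite andbC.
Qed.

Lemma code_law_markov : markov_chain (code_law p f)
  (fun w => w.1.2) (fun w => w.1.1) (fun w => w.2).
Proof.
move=> y x z; rewrite (prob_code_law_fst [pred xy | xy.1 == x]) => x0.
rewrite cond_prob_code_law // /cond_prob.
rewrite (prob_code_law_fst [pred xy | xy.1 == x]).
rewrite (prob_code_law_fst [pred xy | (xy.2 == y) && (xy.1 == x)]).
rewrite [X in X / _ = _](_ : _ =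
  prob p [pred xy | (xy.2 == y) && (xy.1 == x)] * (N x z)%:R / M%:R).
  by rewrite -[X in X / _ = _]mulrA mulrAC.
rewrite -(prob_code_law [pred xy | xy.2 == y]); apply: eq_bigl => w /=.
by rewrite andbAC andbA.
Qed.

(** An outcome of positive probability is produced by at least one of the [M] seeds. *)
Lemma cond_prob_code_law_ge w : 0 < code_law p f w ->
  M%:R^-1 <= cond_prob (code_law p f) [pred v | v.2 == w.2]
                                      [pred v | v.1.1 == w.1.1].
Proof.
case: w => [[x y] z] w0 /=.
rewrite cond_prob_code_law; last first.
  rewrite -prob_code_law_fst; exact: (prob_gt0 code_law_pmf w0 (eqxx x)).
move: w0; rewrite code_lawE => w0.
rewrite ler_peMl ?invr_ge0 // ler1n lt0n; apply: contraTneq w0 => ->.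
by rewrite mulr0 mul0r ltxx.
Qed.

End CodeLaw.

(** The Markov property factors [Q] as the source law times the channel [kap]. Each row of the
    channel is approximated by [uniform_approx], and the row errors are averaged under [p]; the
    averaged mass of the small outcomes is the probability under [Q] on the right. *)
Lemma channel_simulation (A B Z : finType) (p : A * B -> R)
    (Q : A * B * Z -> R) (M : nat) (t : R) :
  is_pmf Q -> (forall xy, prob Q [pred w | w.1 == xy] = p xy) ->
  markov_chain Q (fun w => w.1.2) (fun w => w.1.1) (fun w => w.2) ->
  (0 < M)%N -> 0 < t ->
  exists f : A * 'I_M -> Z,
    l1dist Q (code_law p f) <=
    2 * (prob Q [pred w | cond_prob Q [pred v | v.2 == w.2]
                                      [pred v | v.1.1 == w.1.1] < t] +
         (t * M%:R)^-1).
Proof.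
move=> Qp Qm mk M0 t0.
pose px x := prob Q [pred v | v.1.1 == x].
pose kap x z := cond_prob Q [pred v | v.2 == z] [pred v | v.1.1 == x].
have p1 : \sum_xy p xy = 1.
  have /= [_ <-] := push_pmf fst Qp; apply: eq_bigr => xy _; exact/esym/Qm.
have p0 xy : 0 <= p xy by rewrite -Qm prob_ge0.
have kap_pmf x : 0 < px x -> is_pmf (kap x).
  move=> x0; split=> [z|]; first by rewrite divr_ge0 ?prob_ge0.
  rewrite /kap /cond_prob -mulr_suml -/(px x).
  rewrite -[X in X / _](_ : px x = _) ?mulfV ?gt_eqF // /px /prob.
  rewrite (partition_big snd predT) //=; apply: eq_bigr => z _.
  by apply: eq_bigl => w; rewrite /= andbC.
(* The Markov hypothesis only speaks of [x] with positive probability; for the others both sides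
   vanish. *)
have QE x y z : Q (x, y, z) = p (x, y) * kap x z.
  have [x0|] := ltP 0 (px x); last first.
    rewrite le_eqVlt ltNge prob_ge0 // orbF => /eqP x0.
    by rewrite (prob_eq0 Qp x0) ?/= // -Qm /prob big1 ?mul0r // => -[[? ?] ?]
      /= /eqP[-> _]; apply: (prob_eq0 Qp x0) => /=.
  have := mk y x z x0; rewrite /cond_prob -!/(px x) -/(kap x z).
  have -> : prob Q [pred w | [pred w | w.1.2 == y & w.2 == z] w
      & [pred w | w.1.1 == x] w] = Q (x, y, z).
    rewrite /prob (big_pred1 (x, y, z)) // => -[[x' y'] z'] /=.
    by rewrite !xpair_eqE andbC andbA.
  have -> : prob Q [pred w | [pred w | w.1.2 == y] w & [pred w | w.1.1 == x] w]
      = p (x, y).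
    rewrite -Qm; apply: eq_bigl => -[[x' y'] z'] /=.
    by rewrite xpair_eqE andbC.
  rewrite -[_ / px x * _]mulrAC => /(congr1 ( *%R^~ (px x))).
  by rewrite !divfK ?gt_eqF.
(* Rows with [px x = 0] carry no weight in the distance, so any constant map serves there. *)
have /choice[f0 f0P] : forall x, exists g : 'I_M -> Z, 0 < px x ->
    \sum_z `|kap x z - #|[pred u | g u == z]|%:R / M%:R| <=
    2 * (prob (kap x) [pred z | kap x z < t] + (t * M%:R)^-1).
  move=> x; have [x0|x0] := boolP (0 < px x).
    by have [g gP] := uniform_approx (kap_pmf x x0) M0 t0; exists g.
  have /card_gt0P[[_ z] _] := pmf_card_gt0 Qp.
  by exists (fun=> z).
exists (fun w => f0 w.1 w.2).
pose err x z := `|kap x z - #|[pred u | f0 x u == z]|%:R / M%:R|.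
rewrite /l1dist (eq_bigr (fun w => p w.1 * err w.1.1 w.2)); last first.
  by move=> [[x y] z] _; rewrite code_lawE QE -mulrA -mulrBr normrM (ger0_norm (p0 _)).
rewrite -(pair_bigA _ (fun xy z => p xy * err xy.1 z)) /=.
apply: (@le_trans _ _ (\sum_xy p xy * (2 *
    (prob (kap xy.1) [pred z | kap xy.1 z < t] + (t * M%:R)^-1)))).
  apply: ler_sum => -[x y] _ /=.
  rewrite -mulr_sumr; have [x0|] := ltP 0 (px x).
    by rewrite ler_wpM2l // f0P.
  rewrite le_eqVlt ltNge prob_ge0 // orbF => /eqP x0.
  suff -> : p (x, y) = 0 by rewrite !mul0r.
  by rewrite -Qm /prob big1 // => -[[? ?] ?] /= /eqP[-> _];
    apply: (prob_eq0 Qp x0) => /=.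
under eq_bigr do rewrite mulrCA mulrDr.
rewrite -mulr_sumr ler_pM2l // big_split /= -mulr_suml p1 mul1r lerD2r.
(* By [QE], averaging the small mass of each row under [p] gives back the mass under [Q] of the
   outcomes with [kap] below [t]. *)
rewrite [leRHS]/prob [leRHS]big_mkcond.
rewrite [leRHS](eq_bigr (fun w => if kap w.1.1 w.2 < t then Q (w.1, w.2) else 0));
  last by case.
rewrite -(pair_bigA _ (fun xy z => if kap xy.1 z < t then Q (xy, z) else 0)) /=.
apply: ler_sum => -[x y] _ /=; rewrite -big_mkcond mulr_sumr.
by apply: ler_sum => z _; rewrite QE.
Qed.

End Simulation.

(** * Limits superior, limits superior in probability, and a diagonal argument *)

Section Limits.
Variable R : realType.

(** The limit superior is the infimum, over sets in the filter at infinity, of the suprema of [u] on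
    them; for the converse, the set where [u n <= a + d] is such a set. *)
Lemma limn_esup_leP (u : nat -> R) (a : R) :
  (limn_esup (fun n => (u n)%:E) <= a%:E)%E <->
  (forall d, 0 < d -> \forall n \near \oo, u n <= a + d).
Proof.
rewrite /limn_esup limf_esupE; split=> [ua d d0|ua].
  have /ereal_inf_lt[_ [V VF <-]] :
      (ereal_inf [set ereal_sup ((fun n => (u n)%:E) @` V) | V in \oo] < (a + d)%:E)%E.
    by rewrite (le_lt_trans ua) // lte_fin ltrDl.
  move=> /ltW Vad; apply: filterS VF => n Vn; rewrite -lee_fin.
  by apply: le_trans Vad; apply: ereal_sup_ubound; exists n.
apply/lee_addgt0Pr => d d0; apply: ge_ereal_inf.
exists (ereal_sup ((fun n => (u n)%:E) @` [set n | u n <= a + d])).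
  by exists [set n | u n <= a + d] => //; exact: ua.
by apply: ge_ereal_sup => _ [n /= und <-]; rewrite -EFinD lee_fin.
Qed.

Lemma cvg_invn : (n%:R^-1 : R) @[n --> \oo] --> (0 : R).
Proof. rewrite -cvg_shiftS; exact: cvg_harmonic. Qed.

Lemma squeeze_cvg0 (u v : nat -> R) :
  (\forall n \near \oo, 0 <= u n <= v n) ->
  v n @[n --> \oo] --> (0 : R) -> u n @[n --> \oo] --> (0 : R).
Proof. by move=> uv v0; apply: (squeeze_cvgr uv) => //; exact: cvg_cst. Qed.

Lemma cvg0_le (u : nat -> R) d : u n @[n --> \oo] --> (0 : R) -> 0 < d ->
  \forall n \near \oo, u n <= d.
Proof.
move=> u0 d0; near=> n; apply: le_trans (ler_norm _) _.
by near: n; exact: cvgr0_norm_le.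
Unshelve. all: by end_near. Qed.

(** The infimum may not be attained, but the slack [d] yields a valid threshold below [a + d], and
    raising a threshold shrinks the event. *)
Lemma p_limsup_le_cvg (W : nat -> finType) (P Z : forall n, W n -> R) (a : R) :
  (forall n, (0 < n)%N -> is_pmf (P n)) -> (p_limsup P Z <= a%:E)%E ->
  forall d, 0 < d ->
  prob (P n) [pred w | a + d < Z n w] @[n --> \oo] --> (0 : R).
Proof.
move=> Pp Za d d0.
have /ereal_inf_lt[_ [b /= b0 <-]] : (p_limsup P Z < (a + d)%:E)%E.
  by rewrite (le_lt_trans Za) // lte_fin ltrDl.
rewrite lte_fin => /ltW bad; apply: squeeze_cvg0 b0.
apply: filterS (nbhs_infty_ge 1) => n /= n0.
rewrite prob_ge0 ?le_prob //; try exact: Pp.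
by move=> w _ /=; exact: le_lt_trans.
Qed.

Lemma p_limsup_le (W : nat -> finType) (P Z : forall n, W n -> R) (a : R) :
  (forall d, 0 < d ->
    prob (P n) [pred w | a + d < Z n w] @[n --> \oo] --> (0 : R)) ->
  (p_limsup P Z <= a%:E)%E.
Proof.
move=> Za; apply/lee_addgt0Pr => d d0.
by apply: ereal_inf_lbound; exists (a + d) => //; exact: Za.
Qed.

(* [g n] is a near-minimal [x > 0] with [u n x <= x]. *)
Lemma diagonal_cvg0 (u : nat -> R -> R) (B : R) : 0 < B ->
  (forall n, (0 < n)%N -> u n B <= B) ->
  (forall x, 0 < x -> u n x @[n --> \oo] --> (0 : R)) ->
  exists g : nat -> R,
    [/\ forall n, 0 < g n,
        forall n, (0 < n)%N -> u n (g n) <= g n &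
        g n @[n --> \oo] --> (0 : R)].
Proof.
move=> B0 uB u0.
(* The slack [1 / n] stands in for an infimum that may not be attained; [B] shows that the set is
   nonempty and is the placeholder value at [n = 0]. *)
have /choice[g gP] : forall n, exists x : R, 0 < x /\ ((0 < n)%N ->
    u n x <= x /\ forall y, 0 < y -> u n y <= y -> x <= y + n%:R^-1).
  move=> n; have [->|n0] := posnP n; first by exists B.
  pose S := [set x : R | 0 < x /\ u n x <= x].
  have lbS : has_lbound S by exists 0 => x [/ltW].
  have [||x [x0 ux] xS] := @inf_adherent R S (n%:R^-1).
  - by rewrite invr_gt0 ltr0n.
  - by split=> //; exists B; split=> //; exact: uB.
  exists x; split=> // _; split=> // y y0 uy.
  by rewrite (le_trans (ltW xS)) // lerD2r ge_inf.
exists g; split=> [n|n n0|]; [by case: (gP n)|by case: (gP n) => _ /(_ n0)[]|].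
apply/cvgr0Pnorm_le => e e0.
(* Eventually [u n (e / 2) <= e / 2], so near-minimality gives [g n <= e / 2 + 1 / n]. *)
have e2 : 0 < e / 2 by rewrite divr_gt0.
near=> n.
have n0 : (0 < n)%N by near: n; exact: nbhs_infty_ge.
have [g0 /(_ n0)[_ /(_ _ e2) gn]] := gP n.
rewrite gtr0_norm // (le_trans (gn _)) //.
  by near: n; exact: cvg0_le (u0 _ e2) e2.
rewrite [leRHS]splitr lerD2l; near: n; exact: cvg0_le cvg_invn e2.
Unshelve. all: by end_near. Qed.

Lemma cvg_expRNn (x : R) : 0 < x -> expR (- (n%:R * x)) @[n --> \oo] --> (0 : R).
Proof.
move=> x0; apply: (@squeeze_cvg0 _ (fun n => n%:R^-1 * x^-1)); last first.
  by rewrite -(mul0r x^-1); apply: cvgMl; exact: cvg_invn.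
apply: filterS (nbhs_infty_ge 1) => n /= n0.
have nx : 0 < n%:R * x by rewrite mulr_gt0 ?ltr0n.
rewrite expR_ge0 /= expRN -invfM lef_pV2 ?posrE ?expR_gt0 //.
by rewrite (le_trans _ (expR_ge1Dx _)) // lerDr.
Qed.

End Limits.

(** * From codes to admissible joint laws, and back *)

Section Coding.
Variables (R : realType) (X Y Xh : finType).

Definition admissible (P : forall n : nat, n.-tuple X * n.-tuple Y -> R)
    (eps r : R) (Q : forall n : nat, n.-tuple X * n.-tuple Y * n.-tuple Xh -> R) :=
  [/\ is_joint_extension P Q,
      markov_source Q,
      (mutual_info_rate Q (fun n w => w.1.2) (fun n w => w.2) <= eps%:E)%E &
      (cond_sup_entropy Q (fun n w => w.2) (fun n w => w.1.1) <= r%:E)%E].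

(** Cost and mutual information are unchanged by the pushforward that defines [code_law]; only the
    entropy constraint needs an estimate. *)
Lemma weakly_achievable_admissible (P : forall n : nat, n.-tuple X * n.-tuple Y -> R)
    (c : forall n : nat, n.-tuple X -> n.-tuple Xh -> R) (eps r G : R) :
  is_source P -> weakly_achievable P c eps r G ->
  exists2 Q, admissible P eps r Q & (sup_cost c Q <= G%:E)%E.
Proof.
move=> hP [M [f [M0 rate mi cost]]].
pose Q n := code_law (P n) (f n).
have Qp n : (0 < n)%N -> is_pmf (Q n).
  by move=> n0; apply: code_law_pmf; [exact: hP|exact: M0].
exists Q; last first.
  rewrite /sup_cost; apply: le_trans cost; apply: ereal_inf_le_tmp.
  apply: image_subset => a /= wa.
  rewrite (_ : (fun n => prob (Q n) _) =
    fun n => prob (with_uniform (P n) (M := M n))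
      [pred w | a < c n w.1.1 (f n (w.1.1, w.2))]) //.
  by apply/funext => n; rewrite prob_push.
split.
- move=> n n0; split=> [|xy]; first exact: Qp.
  rewrite (@prob_code_law_fst _ _ _ _ _ _ _ (M0 n n0) (pred1 xy)).
  by rewrite /prob big_pred1_eq.
- by move=> n n0; apply: code_law_markov; exact: M0.
- apply: le_trans mi; rewrite /mutual_info_rate le_eqVlt; apply/orP; left.
  apply/eqP; congr limn_esup; apply/funext => n.
  by rewrite [in LHS]mutual_info_push.
apply: p_limsup_le => d d0; move/limn_esup_leP : rate => rate.
(* The probability is eventually exactly 0: once [ln (M n) / n <= r + d], no outcome of positive
   mass exceeds the threshold. *)
apply: (@squeeze_cvg0 _ _ (fun=> 0)); last exact: cvg_cst.
near=> n; have n0 : (0 < n)%N by near: n; exact: nbhs_infty_ge.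
rewrite prob_ge0 /=; last exact: Qp.
rewrite -[leRHS](_ : prob (Q n) pred0 = 0); last by rewrite /prob big_pred0_eq.
apply: le_prob => [|w Qw /=]; first exact: Qp.
rewrite ltNge => /negP[].
have rn : n%:R^-1 * ln (M n)%:R <= r + d by near: n; exact: rate.
apply: le_trans rn; rewrite ler_pM2l ?invr_gt0 ?ltr0n //.
have MR : 0 < (M n)%:R :> R by rewrite ltr0n M0.
have := cond_prob_code_law_ge (hP n n0) (M0 n n0) Qw.
set k := cond_prob _ _ _ => kM.
have k0 : 0 < k by rewrite (lt_le_trans _ kM) // invr_gt0.
by rewrite div1r ler_ln ?posrE ?invr_gt0 // -[leRHS]invrK lef_pV2 ?posrE ?invr_gt0.
Unshelve. all: by end_near. Qed.

(** The cost hypothesis concerns one threshold [G] from the set whose infimum is [sup_cost], and the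
    code keeps that same threshold. *)
Lemma admissible_weakly_achievable (P : forall n : nat, n.-tuple X * n.-tuple Y -> R)
    (c : forall n : nat, n.-tuple X -> n.-tuple Xh -> R) (eps r G : R)
    (Q : forall n : nat, n.-tuple X * n.-tuple Y * n.-tuple Xh -> R) :
  (0 < #|Xh|)%N -> 0 <= r -> admissible P eps r Q ->
  prob (Q n) [pred w | G < c n w.1.1 w.2] @[n --> \oo] --> (0 : R) ->
  weakly_achievable P c eps r G.
Proof.
move=> /card_gt0P[z0 _] r0 [ext mk mi ent] cost.
have Qp n : (0 < n)%N -> is_pmf (Q n) by move=> /ext[].
pose kap n (w : n.-tuple X * n.-tuple Y * n.-tuple Xh) :=
  cond_prob (Q n) [pred v | v.2 == w.2] [pred v | v.1.1 == w.1.1].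
(* These are the two errors of [channel_simulation] for [t = exp (- n (r + x))] and [M] at least
   [exp (n (r + 2 x))]. *)
pose u n x := prob (Q n) [pred w | r + x < n%:R^-1 * ln (1 / kap n w)] +
  expR (- (n%:R * x)).
have u0 x : 0 < x -> u n x @[n --> \oo] --> (0 : R).
  move=> x0; rewrite -(addr0 0); apply: cvgD; last exact: cvg_expRNn.
  exact: p_limsup_le_cvg Qp ent _ x0.
(* Each summand is at most 1, so 2 can start the diagonal choice. *)
have u2 n : (0 < n)%N -> u n 2 <= 2.
  move=> n0; rewrite (_ : 2 = 1 + 1) //; apply: lerD; first exact/prob_le1/Qp.
  by rewrite -expR0 ler_expR oppr_le0 mulr_ge0.
have [g [g0 ug gcvg]] := diagonal_cvg0 (ltr0Sn R 1) u2 u0.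
pose m n := expR (n%:R * (r + 2 * g n)).
have m1 n : 1 <= m n.
  by rewrite -expR0 ler_expR mulr_ge0 // addr_ge0 // mulr_ge0 // ltW.
(* Rounding up keeps [M n] positive and at least [m n]. Since [1 <= m n], it at most doubles it,
   which costs [ln 2 / n] in rate. *)
pose M n := (Num.trunc (m n)).+1.
have mM n : m n <= (M n)%:R by rewrite ltW // truncnS_gt.
have Mm n : (M n)%:R <= 2 * m n.
  have m0 : 0 <= m n by rewrite expR_ge0.
  have /andP[+ _] := truncn_itv m0; have := m1 n.
  rewrite /M -natr1; lra.
have /= sim n : exists f : n.-tuple X * 'I_(M n) -> n.-tuple Xh,
    (0 < n)%N -> l1dist (Q n) (code_law (P n) f) <= 2 * g n.
  have [n0|n0] := posnP n; first by exists (fun=> [tuple of nseq n z0]); rewrite n0.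
  have [Qn Qm] := ext n n0.
  have t0 : 0 < expR (- (n%:R * (r + g n))) by exact: expR_gt0.
  have [f fP] := channel_simulation Qn Qm (mk n n0) (ltn0Sn _ : (0 < M n)%N) t0.
  exists f => _; apply: (le_trans fP); rewrite ler_pM2l //.
  apply: le_trans (ug n n0); apply: lerD.
    apply: le_prob => // w Qw /=; rewrite -/(kap n w) => kt.
    have k0 : 0 < kap n w.
      by apply: divr_gt0; apply: (prob_gt0 Qn Qw) => /=; rewrite !eqxx.
    rewrite div1r lnV ?posrE // -(ltr_pM2l (_ : 0 < n%:R)) ?ltr0n //.
    rewrite mulrA mulfV ?pnatr_eq0 -?lt0n // mul1r ltrNr.
    by rewrite -[ltRHS]expRK ltr_ln ?posrE ?expR_gt0.
  rewrite expRN invfM invrK.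
  rewrite (_ : - (n%:R * g n) = n%:R * (r + g n) - n%:R * (r + 2 * g n));
    last by ring.
  rewrite expRD ler_pM2l ?expR_gt0 // expRN lef_pV2 ?posrE ?expR_gt0 ?ltr0n //.
  exact: mM.
pose f n := sval (cid (sim n)).
have fP n : (0 < n)%N -> l1dist (Q n) (code_law (P n) (f n)) <= 2 * g n.
  exact: (svalP (cid (sim n))).
have g2 : 2 * g n @[n --> \oo] --> (0 : R) by rewrite -(mulr0 2); exact: cvgMr.
have Pp n : (0 < n)%N -> is_pmf (P n).
  move=> /[dup] n0 /ext[Qn Qm].
  rewrite (_ : P n = push (Q n) fst); first exact: push_pmf.
  by apply/funext => xy; rewrite -Qm.
exists M, f; split=> //.
- apply/limn_esup_leP => d d0.
  have h : n%:R^-1 * ln 2 + 2 * g n @[n --> \oo] --> (0 : R).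
    rewrite -(addr0 0); apply: cvgD => //; rewrite -(mul0r (ln 2)).
    by apply: cvgMl; exact: cvg_invn.
  near=> n; have n0 : (0 < n)%N by near: n; exact: nbhs_infty_ge.
  have nR : 0 < n%:R :> R by rewrite ltr0n.
  apply: (@le_trans _ _ (r + (n%:R^-1 * ln 2 + 2 * g n))); last first.
    by rewrite lerD2l; near: n; exact: cvg0_le.
  have -> : r + (n%:R^-1 * ln 2 + 2 * g n) = n%:R^-1 * ln (2 * m n).
    rewrite lnM ?posrE ?expR_gt0 // expRK mulrDr mulrA mulVf ?gt_eqF //.
    by rewrite mul1r addrCA.
  by rewrite ler_pM2l ?invr_gt0 // ler_ln ?posrE ?mulr_gt0 ?expR_gt0 ?ltr0n.
- apply/limn_esup_leP => d d0; move/limn_esup_leP : mi => mi.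
  have d2 : 0 < d / 2 by rewrite divr_gt0.
  (* The alphabets of n-tuples have log-cardinalities summing to [n * K], so after division by [n]
     the error of [mutual_info_le_l1dist] is at most [2 * g n * K + 2 / n]. *)
  pose K : R := ln #|Xh|%:R + ln (#|Y| * #|Xh|)%:R.
  have h : 2 * g n * K + n%:R^-1 * 2 @[n --> \oo] --> (0 : R).
    rewrite -(addr0 0) -[X in X + 0](mul0r K) -[X in _ + X](mul0r 2).
    by apply: cvgD; apply: cvgMl => //; exact: cvg_invn.
  near=> n; have n0 : (0 < n)%N by near: n; exact: nbhs_infty_ge.
  have nR : 0 < n%:R :> R by rewrite ltr0n.
  have Qn := Qp n n0.
  have Cn : is_pmf (code_law (P n) (f n)) by apply: code_law_pmf => //; exact: Pp.
  have PQ : push (Q n) (fun w => w.1.2) =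
      push (code_law (P n) (f n)) (fun w => w.1.2).
    apply/funext => y; rewrite /push.
    rewrite (@prob_code_law_fst _ _ _ _ _ _ _ _ [pred xy | xy.2 == y]) //.
    have -> : P n = push (Q n) fst by apply/funext => xy; rewrite -(ext n n0).2.
    by rewrite prob_push.
  have := mutual_info_le_l1dist (fun w => w.2) Qn Cn PQ.
  rewrite mutual_info_push => /(ler_wpM2l (_ : 0 <= n%:R^-1)).
  rewrite invr_ge0 ler0n => /(_ isT) H; apply: le_trans H _.
  rewrite card_prod !card_tuple -expnMn !natrX.
  have lnn k : (0 < k)%N -> ln (k%:R ^+ n) = n%:R * ln k%:R :> R.
    by move=> k0; rewrite lnXn ?ltr0n // mulr_natl.
  have /card_gt0P[[[x y] z] _] := pmf_card_gt0 Qn.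
  have Y0 : (0 < #|Y|)%N by apply/card_gt0P; exists (tnth y (Ordinal n0)).
  have Xh0 : (0 < #|Xh|)%N by apply/card_gt0P; exists z0.
  rewrite !lnn ?muln_gt0 ?Y0 // -mulrDr -/K.
  have K0 : 0 <= K by rewrite addr_ge0 // ln_ge0 // ler1n ?muln_gt0 ?Y0.
  rewrite [l1dist _ _ * _]mulrCA 2!mulrDr mulKf ?gt_eqF // -addrA (splitr d) [leRHS]addrA.
  rewrite lerD //; first by near: n; exact: mi.
  apply: (@le_trans _ _ (2 * g n * K + n%:R^-1 * 2)); last first.
    by near: n; exact: cvg0_le.
  by rewrite lerD2r ler_wpM2r // fP.
- apply: ereal_inf_lbound; exists G => //=.
  apply: (@squeeze_cvg0 _ _ (fun n =>
    prob (Q n) [pred w | G < c n w.1.1 w.2] + 2 * g n)); last first.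
    by rewrite -(addr0 0); exact: cvgD.
  near=> n; have n0 : (0 < n)%N by near: n; exact: nbhs_infty_ge.
  rewrite prob_ge0 /=; last by apply: uniform_law_pmf => //; exact: Pp.
  have := prob_le_l1dist (Q n) (code_law (P n) (f n)) [pred w | G < c n w.1.1 w.2].
  by rewrite prob_push => /le_trans; apply; rewrite lerD2l fP.
Unshelve. all: by end_near. Qed.

End Coding.

Theorem theorem2 (R : realType) (X Y Xh : finType)
    (hX : (0 < #|X|)%N) (hY : (0 < #|Y|)%N) (hXh : (0 < #|Xh|)%N)
    (P : forall n : nat, n.-tuple X * n.-tuple Y -> R) (hP : is_source P)
    (c : forall n : nat, n.-tuple X -> n.-tuple Xh -> R)
    (hc0 : is_cost c) (hcB : uniformly_bounded c)
    (eps r : R) (heps : 0 <= eps) (hr : 0 <= r) :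
  min_worst_cost P c eps r =
  ereal_inf [set sup_cost c Q | Q in
    [set Q : forall n : nat, n.-tuple X * n.-tuple Y * n.-tuple Xh -> R |
      [/\ is_joint_extension P Q,
          markov_source Q,
          (mutual_info_rate Q (fun n w => w.1.2) (fun n w => w.2) <= eps%:E)%E &
          (cond_sup_entropy Q (fun n w => w.2) (fun n w => w.1.1) <= r%:E)%E]]].
Proof.
apply/eqP; rewrite eq_le; apply/andP; split; last first.
  apply: le_ereal_inf_tmp => _ [G [_ Gach] <-].
  have [Q adm QG] := weakly_achievable_admissible hP Gach.
  by apply: ge_ereal_inf; exists (sup_cost c Q) => //; exists Q.
apply: le_ereal_inf_tmp => _ [Q adm <-].
(* [sup_cost c Q] is itself an infimum of thresholds [G]; it suffices that each of them is
   achievable. *)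
apply: le_ereal_inf_tmp => _ [G /= G0 <-].
apply: ereal_inf_lbound; exists G => //; split; last exact: admissible_weakly_achievable adm G0.
(* [min_worst_cost] ranges over nonnegative [G] only. For a negative [G], nonnegativity of the costs
   gives the event probability 1 for every [n > 0], so it cannot tend to 0. *)
have [//|Gneg] := leP 0 G.
near \oo => n.
have n0 : (0 < n)%N by near: n; exact: nbhs_infty_ge.
have [ext _ _ _] := adm; have [[_ Q1] _] := ext n n0.
have : prob (Q n) [pred w | G < c n w.1.1 w.2] <= 2^-1.
  by near: n; apply: cvg0_le; rewrite ?invr_gt0.
rewrite /prob (eq_bigl predT) ?Q1; first by lra.
by move=> w /=; rewrite (lt_le_trans Gneg) // hc0.
Unshelve. all: by end_near. Qed.
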